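(* Let $H\in C^2(\mathbb{R}^N\otimes\mathbb{R}^n)$, $H\ge 0$, be such that there exists a positive increasing $\omega\in C^0(0,\infty)$ with $\omega(0^+)=0$ satisfying $$H_P(Q)Q^\top:\xi\otimes\xi\;\ge\;\omega\big(|\xi^\top Q|\big)\qquad\text{for all }Q\in\mathbb{R}^N\otimes\mathbb{R}^n,\ \xi\in\mathbb{S}^{N-1}$$ (with $\omega(0):=0$). Suppose $u\in C^2(\mathbb{R}^n)^N$ is an Aronsson map, that is, it solves the Aronsson PDE system $$\Big(H_P(Du)\otimes H_P(Du)+H(Du)\,[H_P(Du)]^\perp H_{PP}(Du)\Big):D^2u=0 .$$ Then, for any open set $\Omega\subseteq\mathbb{R}^n$ on which $H_P(Du)$ has constant rank and any $C^1$ unit vector field $e:\mathbb{R}^n\to\mathbb{S}^{N-1}$, there exist an orthogonal split $e=h+v$ into a horizontal component $h$ and a vertical component $v$ (that is, $h(x)\in \mathrm{R}\big(H_P(Du(x))\big)$ and $v(x)\in \mathrm{N}\big(H_P(Du(x))^\top\big)$), and an open cover of $\Omega$ by the pair $\{\Omega^\top,\Omega^\perp\}$ given by $$\Omega^\top=\{x\in\Omega: h(x)\ne0\},\qquad \Omega^\perp=\{x\in\Omega: v(x)\neq0\},$$ such that the flow map $\Phi:\mathbb{R}\times\Omega^\top\to\Omega^\top$ of $$\frac{\partial}{\partial t}\Phi(t,x)=h\big(\Phi(t,x)\big)^\top H_P\big(Du(\Phi(t,x))\big),\qquad \Phi(0,x)=x,$$ satisfies along trajectories $$H\big(Du(\Phi(t,x))\big)=H\big(Du(x)\big),\qquad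 h\big(\Phi(t,x)\big)^\top\frac{\partial}{\partial t}\Big(u\big(\Phi(t,x)\big)\Big)\ge0,$$ and also $u$ solves on $\Omega^\perp$ the PDE system $$v^\top Du=0,\qquad Dv:H_P(Du)=0 .$$
   Context: $\mathbb{R}^N\otimes\mathbb{R}^n$ is the space of real $N\times n$ matrices; $A:B$ is the Euclidean inner product of matrices of the same size; $\xi\otimes\xi=(\xi_\alpha\xi_\beta)$; $\mathbb{S}^{N-1}$ is the unit sphere of $\mathbb{R}^N$. $Du=(D_iu_\alpha)$ is the $N\times n$ gradient matrix; $H_P=(\partial H/\partial P_{\alpha i})$ and $H_{PP}=(\partial^2H/\partial P_{\alpha i}\partial P_{\beta j})$. Repeated indices are summed (Greek from $1$ to $N$, Latin from $1$ to $n$). $\mathrm{R}(H_P(Du(x)))\subseteq\mathbb{R}^N$ is the range of $H_P(Du(x)):\mathbb{R}^n\to\mathbb{R}^N$, $\mathrm{N}(H_P(Du(x))^\top)$ is the null space of $H_P(Du(x))^\top:\mathbb{R}^N\to\mathbb{R}^n$, and $[H_P(Du)]^\perp$ is the orthogonal projection of $\mathbb{R}^N$ on $\mathrm{N}(H_P(Du)^\top)$. In index form, the Aronsson system reads, for each $\alpha=1,\dots,N$, $$\Big(H_{P_{\alpha i}}(Du)H_{P_{\beta j}}(Du)+H(Du)\,[H_P(Du)]^\perp_{\alpha\gamma}\,H_{P_{\gamma i}P_{\beta j}}(Du)\Big)D^2_{ij}u_\beta=0 .$$ The vector $h^\top H_P(Du)\in\mathbb{R}^n$ has components $h_\beta H_{P_{\beta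 j}}(Du)$, and $Dv:H_P(Du)=D_iv_\alpha\,H_{P_{\alpha i}}(Du)$.
   Formalization: The flow map is taken as the unique maximal local flow in Ω^⊤, on an open time interval around 0 for each x, instead of on all of ℝ; a global flow fails e.g. for N=n=1, H(P)=P², u(x)=x, e=1, Ω=(0,1), where Φ=x+2t leaves Ω. *)

(* Defs.v *)
From HB Require Import structures.
From mathcomp Require Import all_boot all_order all_algebra.
From mathcomp Require Import all_classical all_reals all_analysis.

Set Implicit Arguments.
Unset Strict Implicit.
Unset Printing Implicit Defensive.

Import Order.TTheory GRing.Theory Num.Theory.
Import numFieldNormedType.Exports.

Local Open Scope classical_set_scope.
Local Open Scope ring_scope.

(* Points of R^n and of R^N are row vectors, as in the library's Jacobian 'J.
   Hence, for X : 'M_(N, n) and a row vector w of length N, the product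
   w *m X is w^T X, the range R(X) is the row space of X^T, and the null
   space N(X^T) is the row space of kermx X. *)

Section Euclidean.
Context {R : realType}.

Definition mxip m p (A B : 'M[R]_(m, p)) : R := \sum_i \sum_j A i j * B i j.

(* The library norm `|_| on matrices is the sup norm, so the Euclidean norm
   has to be introduced separately. *)
Definition enorm m p (A : 'M[R]_(m, p)) : R := Num.sqrt (mxip A A).

Definition tensor m (xi : 'rV[R]_m) : 'M[R]_m :=
  \matrix_(a, b) (xi 0 a * xi 0 b).

(* Projection onto the row space of K along its orthogonal complement
   {w | w *m K^T = 0}; over a numClosedFieldType this is proj_ortho. *)
Definition orth_proj m p (K : 'M[R]_(p, m)) : 'M[R]_m :=
  proj_mx <<K>>%MS (kermx K^T).

(* The matrix [X]^perp acting on column vectors; the transpose is there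
   because orth_proj acts on row vectors from the right. *)
Definition perp N n (X : 'M[R]_(N, n)) : 'M[R]_N := (orth_proj (kermx X))^T.

End Euclidean.

Section Calculus.
Context {R : realType}.

(* Used in finite dimension only, where continuity of every directional
   derivative is continuity of x |-> 'd f x. *)
Definition C1 (V W : normedModType R) (f : V -> W) : Prop :=
  (forall x, differentiable f x) /\ (forall v, continuous ('D_v f)).

Definition C2 (V W : normedModType R) (f : V -> W) : Prop :=
  C1 f /\ (forall v, C1 ('D_v f)).

(* (Du)_{a i} = D_i u_a, whereas 'J u x is the n x N matrix (D_i u_a)_{i a}. *)
Definition grad N n (u : 'rV[R]_n -> 'rV[R]_N) (x : 'rV[R]_n) : 'M[R]_(N, n) :=
  ('J u x)^T.

Definition hess N n (u : 'rV[R]_n -> 'rV[R]_N) (x : 'rV[R]_n)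
    (i j : 'I_n) (b : 'I_N) : R :=
  'D_(delta_mx 0 i) (fun y => grad u y b j) x.

Definition HP N n (H : 'M[R]_(N, n) -> R) (P : 'M[R]_(N, n)) : 'M[R]_(N, n) :=
  \matrix_(a, i) 'D_(delta_mx a i) H P.

Definition HPP N n (H : 'M[R]_(N, n) -> R) (P : 'M[R]_(N, n))
    (a : 'I_N) (i : 'I_n) (b : 'I_N) (j : 'I_n) : R :=
  'D_(delta_mx b j) (fun Q => HP H Q a i) P.

Definition aronsson N n (H : 'M[R]_(N, n) -> R) (u : 'rV[R]_n -> 'rV[R]_N) :
    Prop :=
  forall (x : 'rV[R]_n) (a : 'I_N),
    \sum_b \sum_i \sum_j
      (HP H (grad u x) a i * HP H (grad u x) b j
       + H (grad u x) * \sum_c perp (HP H (grad u x)) a c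
                                * HPP H (grad u x) c i b j)
      * hess u x i j b = 0.

(* "Increasing" is taken in the weak sense, which as a hypothesis covers
   strictly increasing functions too. *)
Definition modulus (omega : R -> R) : Prop :=
  [/\ omega 0 = 0,
      forall s, 0 < s -> 0 < omega s,
      forall s t, 0 < s -> s <= t -> omega s <= omega t,
      forall s, 0 < s -> {for s, continuous omega} &
      omega s @[s --> 0^'+] --> (0 : R)].

Definition coercive_HP N n (H : 'M[R]_(N, n) -> R) (omega : R -> R) : Prop :=
  forall (Q : 'M[R]_(N, n)) (xi : 'rV[R]_N), enorm xi = 1 ->
    omega (enorm (xi *m Q)) <= mxip (HP H Q *m Q^T) (tensor xi).

End Calculus.

Section Flow.
Context {R : realType}.

Definition integral_curve (V : normedModType R) (F : V -> V) (A : set V)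
    (I : set R) (g : R -> V) : Prop :=
  forall t, I t -> A (g t) /\ is_derive t (1 : R) g (F (g t)).

(* The flow of F on A.  Trajectories may leave A or blow up in finite time,
   so t |-> Phi t x is the maximal integral curve in A through x, defined on
   an open interval J x around 0; J x is the whole line whenever a global
   trajectory exists.  The last condition includes uniqueness.  Values of
   J and Phi outside the domain are irrelevant. *)
Definition flow (V : normedModType R) (F : V -> V) (A : set V)
    (J : V -> set R) (Phi : R -> V -> V) : Prop :=
  forall x, A x ->
    [/\ [/\ open (J x), is_interval (J x) & J x 0],
        Phi 0 x = x,
        integral_curve F A (J x) (fun t => Phi t x) &
        forall (I : set R) (g : R -> V),
          open I -> is_interval I -> I 0 -> g 0 = x ->
          integral_curve F A I g ->
          I `<=` J x /\ (forall t, I t -> g t = Phi t x)].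

End Flow.

(* Main.v *)
Require Import Defs.
From HB Require Import structures.
From mathcomp Require Import all_boot all_order all_algebra.
From mathcomp Require Import all_classical all_reals all_analysis.
From mathcomp Require Import ring lra.
Import Order.TTheory GRing.Theory Num.Theory.
Import numFieldNormedType.Exports.
Local Open Scope classical_set_scope.
Local Open Scope ring_scope.

(** Put M(x) = H_P(Du(x)).  By the chain rule the first term of the system is
M D(H(Du)), which lies in the range of M, while the second one is
H(Du) [M]^perp Div M, which lies in the orthogonal complement of that range.
Hence both vanish: D(H(Du)) is annihilated by M, so H(Du) is constant along
curves with velocity w^T M, and H(Du) [M]^perp Div M = 0.

Let v be the projection of e on N(M^T) and h = e - v.  As v^T M = 0, the field
h^T M equals e^T M.  It is therefore C^1 and has a flow, even though h need not
be continuous outside Omega.  On Omega the rank of M is constant, which makes v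
differentiable.  Testing the coercivity with h gives the monotonicity of u along
the flow; testing it with v gives omega(|v^T Du| / |v|) <= 0, hence v^T Du = 0.
Differentiating v^T M = 0 gives Dv : M = - v . Div M, which vanishes where
H(Du) <> 0; where H(Du) = 0 the nonnegative H attains its minimum, so M = 0. *)

(** * Curves and the mean value inequality *)

Lemma mx_coord_norm {R : realType} {m n : nat} (A : 'M[R]_(m, n)) i j :
  `|A i j| <= `|A|.
Proof.
rewrite [leRHS]/Num.Def.normr/= mx_normrE.
exact: (le_bigmax _ (fun k => `|A k.1 k.2|) (i, j)).
Qed.

Lemma mx_norm_le {R : realType} {m n : nat} (A : 'M[R]_(m, n)) (K : R) :
  0 <= K -> (forall i j, `|A i j| <= K) -> `|A| <= K.
Proof.
move=> K0 AK; rewrite /Num.Def.normr/= mx_normrE; exact: bigmax_le.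
Qed.

Lemma is_derive_coord {R : realType} {V : normedModType R} {m n : nat}
  (g : V -> 'M[R]_(m, n)) (t v : V) (dg : 'M[R]_(m, n)) i j :
  is_derive t v g dg -> is_derive t v (fun s => g s i j) (dg i j).
Proof.
move=> [dg1 <-]; rewrite derive_mx// mxE; apply: derivableP.
exact/(derivable_mxP _ _ _).1.
Qed.

Lemma is_derive_mx {R : realType} {V : normedModType R} {m n : nat}
  (g : V -> 'M[R]_(m, n)) (t v : V) (dg : 'M[R]_(m, n)) :
  (forall i j, is_derive t v (fun s => g s i j) (dg i j)) -> is_derive t v g dg.
Proof.
move=> gd; have dv : derivable g t v.
  by apply/derivable_mxP => i j; have [] := gd i j.
apply: DeriveDef => //; rewrite derive_mx//; apply/matrixP => i j.
by rewrite mxE; have [_ ->] := gd i j.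
Qed.

Lemma is_derive1_continuous {R : realType} {V : normedModType R} (g : R -> V)
  (t : R) dg : is_derive t (1 : R) g dg -> {for t, continuous g}.
Proof. by move=> [/derivable1_diffP/differentiable_continuous]. Qed.

Lemma is_interval_itv {R : realType} (A : set R) (a b : R) :
  is_interval A -> A a -> A b -> {in `[a, b], forall t, A t}.
Proof. by move=> iA Aa Ab t /itvP tab; apply: (iA a b) => //; rewrite !tab. Qed.

Lemma is_intervalI {R : realType} (A B : set R) :
  is_interval A -> is_interval B -> is_interval (A `&` B).
Proof.
by move=> iA iB x y [Ax Bx] [Ay By] z xyz; split; [exact: (iA x y)|exact: (iB x y)].
Qed.

(** The norm is the sup norm, so the scalar mean value theorem in each entry suffices. The endpoints
    are unordered, to cover both directions of time, and subtracting the fixed slope [c] turns the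
    bound into a first-order expansion. *)
Lemma mean_value_le {R : realType} {m n : nat} (g dg : R -> 'M[R]_(m, n))
    (c : 'M[R]_(m, n)) (A : set R) (K a b : R) :
  is_interval A -> A a -> A b -> 0 <= K ->
  (forall t, A t -> is_derive t (1 : R) g (dg t) /\ `|dg t - c| <= K) ->
  `|g b - g a - (b - a) *: c| <= K * `|b - a|.
Proof.
move=> iA Aa Ab K0 gdg; wlog ab : a b Aa Ab / a <= b.
  move=> W; have [/W|/ltW/W] := leP a b; first exact.
  by rewrite -[b - a]opprB scaleNr -[g b - g a]opprB -opprD !normrN; apply.
apply: mx_norm_le => [|i j]; first by rewrite mulr_ge0.
have dc t : A t -> is_derive t (1 : R) (fun s => g s i j) (dg t i j).
  by move=> /gdg[gd _]; exact: is_derive_coord.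
have [||t tab] := @MVT_segment R (fun s => g s i j) (fun s => dg s i j) _ _ ab.
- by move=> t tab; apply/dc/(is_interval_itv _ _ _ iA Aa Ab); exact: subset_itv_oo_cc.
- apply: continuous_in_subspaceT => t; rewrite inE => tab.
  by apply/is_derive1_continuous/dc/(is_interval_itv _ _ _ iA Aa Ab).
rewrite !mxE => ->; rewrite mulrC -mulrBr normrM mulrC.
apply: ler_wpM2r => //; have [_] := gdg _ (is_interval_itv _ _ _ iA Aa Ab t tab).
by apply: le_trans; rewrite (le_trans _ (mx_coord_norm _ i j))// !mxE.
Qed.

Lemma mean_value_cst {R : realType} {m n : nat} (g : R -> 'M[R]_(m, n))
    (A : set R) (a b : R) : is_interval A -> A a -> A b ->
  (forall t, A t -> is_derive t (1 : R) g 0) -> g a = g b.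
Proof.
move=> iA Aa Ab dg; have := @mean_value_le R m n g (cst 0) 0 A 0 a b iA Aa Ab.
rewrite mul0r scaler0 subr0 => /(_ (lexx _)) H.
apply/esym/eqP; rewrite -subr_eq0 -normr_le0; apply: H => t /dg ?.
by split=> //=; rewrite subr0 normr0.
Qed.

Lemma mean_value_cstr {R : realType} (g : R -> R) (A : set R) (a b : R) :
  is_interval A -> A a -> A b ->
  (forall t, A t -> is_derive t (1 : R) g 0) -> g a = g b.
Proof.
move=> iA Aa Ab dg; pose f s : 'rV[R]_1 := const_mx (g s).
suff /matrixP/(_ 0 0) : f a = f b by rewrite !mxE.
apply: (mean_value_cst f A) => // t /dg dgt; apply: is_derive_mx => i j.
by rewrite mxE; under eq_fun do rewrite mxE.
Qed.

(** After division by [h] the remainder is at most [C * |h|]. Such an estimate survives pointwise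
    limits, which gives the derivative of the Picard limit without exchanging limit and
    differentiation. *)
Lemma is_derive1_quadratic {R : realType} {V : normedModType R} (g : R -> V)
    (s d C : R) (l : V) : 0 < d ->
  (forall t, `|t - s| < d -> `|g t - g s - (t - s) *: l| <= C * `|t - s| ^+ 2) ->
  is_derive s (1 : R) g l.
Proof.
move=> d0 gC.
suff H : (fun h : R => h^-1 *: (g (h *: (1 : R) + s) - g s)) @ 0^' --> l.
  by apply: DeriveDef; [apply/cvg_ex; exists l|exact: cvg_lim H].
apply/cvgrPdist_le => e e0; near=> h.
have h0 : h != 0 by near: h; exact: nbhs_dnbhs_neq.
have hd : `|h| < d by near: h; exact: dnbhs0_lt.
(* [C] may be zero or negative; [|C| + 1] is a positive upper bound for it. *)
have hC : `|h| <= e / (`|C| + 1).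
  by near: h; apply: dnbhs0_le; rewrite divr_gt0// ltr_wpDl.
have := gC (h + s); rewrite addrK => /(_ hd); rewrite [h *: 1]mulr1.
move: (g (h + s) - g s) => z zC.
have -> : l - h^-1 *: z = - (h^-1 *: (z - h *: l)).
  by rewrite scalerBr scalerA mulVf// scale1r opprB.
rewrite normrN normrZ normfV.
rewrite ler_pdivrMl ?normr_gt0//; apply: (le_trans zC).
rewrite expr2 mulrA mulrC ler_wpM2l//.
rewrite ler_pdivlMr ?ltr_wpDl// in hC; apply: le_trans hC.
rewrite mulrC ler_wpM2l//; have := ler_norm C; lra.
Unshelve. all: by end_near. Qed.

(** The geometric error tends to 0. Through this lemma estimates on the Picard iterates pass to
    their limit. *)
Lemma ler_add_half {R : realType} (a b c : R) :
  (forall k, a <= b + c * 2^-1 ^+ k) -> a <= b.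
Proof.
move=> abc.
have H : (fun k => b + geometric c 2^-1 k) @ \oo --> b + 0.
  by apply: cvgD; [exact: cvg_cst|apply: cvg_geometric; rewrite ger0_norm; lra].
by rewrite -[b]addr0; apply: (cvgr_to_ge H); exact: nearW.
Qed.

Lemma cvg_half_steps {R : realType} {m n : nat} (x : nat -> 'M[R]_(m, n)) (C : R) :
  (forall k, `|x k.+1 - x k| <= C * 2^-1 ^+ k) ->
  exists l, forall k, `|x k - l| <= 2 * C * 2^-1 ^+ k.
Proof.
move=> xC.
have C0 : 0 <= C by have := xC 0%N; rewrite expr0 mulr1 => /(le_trans (normr_ge0 _)).
(* The factor [1 - 2^-p] comes from the partial geometric sum; it is what makes the induction on [p]
   close. *)
have step k p : `|x (k + p)%N - x k| <= 2 * C * 2^-1 ^+ k * (1 - 2^-1 ^+ p).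
  elim: p => [|p IH]; first by rewrite addn0 subrr normr0 expr0 subrr mulr0.
  rewrite addnS -(subrKA (x (k + p)%N)).
  apply: le_trans (ler_normD _ _) _; apply: le_trans (lerD (xC _) IH) _.
  by rewrite exprD exprS; lra.
have h0 k : 0 <= 2^-1 ^+ k :> R by rewrite exprn_ge0.
have bnd k p : (k <= p)%N -> `|x p - x k| <= 2 * C * 2^-1 ^+ k.
  move=> kp; have := step k (p - k)%N; rewrite subnKC// => /le_trans; apply.
  have := h0 (p - k)%N; have : 0 <= 2 * C * 2^-1 ^+ k by rewrite !mulr_ge0.
  nra.
have : cvgn x.
  apply/cauchy_cvgP; apply/cauchyP => e e0.
  have : (fun k => geometric (2 * C) 2^-1 k) @ \oo --> (0 : R).
    by apply: cvg_geometric; rewrite ger0_norm; lra.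
  move=> /cvgrPdist_lt/(_ _ e0)[k _ /(_ k (leqnn _))].
  rewrite /= sub0r normrN => H; exists (x k); exists k => // p /= kp.
  rewrite -ball_normE /= distrC; apply: le_lt_trans (bnd _ _ kp) _.
  exact: le_lt_trans (ler_norm _) H.
move=> xcvg; exists (limn x) => k.
have H : (fun p => `|x k - x p|) @ \oo --> `|x k - limn x|.
  by apply: cvg_norm; apply: cvgB => //; exact: cvg_cst.
by apply: (cvgr_to_le H); exists k => // p /= kp; rewrite distrC; exact: bnd.
Qed.

(** * Maps of class C1 *)

Lemma continuous_sumr {R : realType} {T : topologicalType} {W : normedModType R}
  (I : Type) (r : seq I) (f : I -> T -> W) :
  (forall i, continuous (f i)) -> continuous (fun x => \sum_(i <- r) f i x).
Proof.
move=> cf; elim: r => [|i r IH].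
  by under eq_fun do rewrite big_nil; exact: cst_continuous.
under eq_fun do rewrite big_cons.
by move=> x; apply: continuousD; [exact: cf|exact: IH].
Qed.

Lemma differentiable_sumr {R : realType} {V W : normedModType R}
  (I : Type) (r : seq I) (f : I -> V -> W) x :
  (forall i, differentiable (f i) x) ->
  differentiable (fun y => \sum_(i <- r) f i y) x.
Proof.
move=> df; elim: r => [|i r IH].
  by under eq_fun do rewrite big_nil; exact: differentiable_cst.
under eq_fun do rewrite big_cons.
by apply: differentiableD; [exact: df|exact: IH].
Qed.

Lemma derive_sumr {R : realType} {V W : normedModType R}
  (I : Type) (r : seq I) (f : I -> V -> W) x v :
  (forall i, differentiable (f i) x) ->
  'D_v (fun y => \sum_(i <- r) f i y) x = \sum_(i <- r) 'D_v (f i) x.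
Proof.
move=> df; elim: r => [|i r IH].
  rewrite big_nil (_ : (fun y => _) = cst 0) ?derive_cst//.
  by apply/funext => y; rewrite big_nil.
rewrite big_cons -IH (_ : (fun y => _) = f i \+ fun y => \sum_(j <- r) f j y); last first.
  by apply/funext => y; rewrite big_cons.
apply: deriveD; apply: diff_derivable => //.
exact: differentiable_sumr.
Qed.

Lemma continuous_mx {R : realType} {T : topologicalType} {m n : nat}
  (f : T -> 'M[R]_(m, n)) :
  (forall i j, continuous (fun x => f x i j)) -> continuous f.
Proof.
move=> cf; rewrite (_ : f = fun x => \sum_i \sum_j f x i j *: delta_mx i j); last first.
  by apply/funext => y; exact: matrix_sum_delta.
do 2!apply: continuous_sumr => ?.
by move=> x; apply: continuousZr_tmp; exact: cf.
Qed.

Lemma continuous_coord_comp {R : realType} {T : topologicalType} {m n : nat}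
  (f : T -> 'M[R]_(m, n)) x i j :
  {for x, continuous f} -> {for x, continuous (fun y => f y i j)}.
Proof.
move=> cf; apply: (@continuous_comp _ _ _ f (fun A : 'M[R]_(m, n) => A i j)) => //.
exact: coord_continuous.
Qed.

Lemma differentiable_mx {R : realType} {V : normedModType R} {m n : nat}
  (f : V -> 'M[R]_(m, n)) x :
  (forall i j, differentiable (fun y => f y i j) x) -> differentiable f x.
Proof.
move=> df; rewrite (_ : f = fun x => \sum_i \sum_j f x i j *: delta_mx i j); last first.
  by apply/funext => y; exact: matrix_sum_delta.
do 2!apply: differentiable_sumr => ?.
exact: differentiableZl.
Qed.

Lemma differentiable_coord_comp {R : realType} {V : normedModType R} {m n : nat}
  (f : V -> 'M[R]_(m, n)) x i j :
  differentiable f x -> differentiable (fun y => f y i j) x.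
Proof.
move=> df.
apply: (differentiable_comp df (differentiable_coord (f x) i j)).
Qed.

Lemma derive_coord {R : realType} {V : normedModType R} {m n : nat}
  (f : V -> 'M[R]_(m, n)) x v i j :
  differentiable f x -> 'D_v (fun y => f y i j) x = 'D_v f x i j.
Proof. by move=> df; rewrite derive_mx ?mxE//; exact: diff_derivable. Qed.

Lemma derive_comp {R : realType} {U V W : normedModType R} (f : U -> V)
  (g : V -> W) x v : differentiable f x -> differentiable g (f x) ->
  'D_v (fun y => g (f y)) x = 'D_('D_v f x) g (f x).
Proof.
move=> df dg; rewrite (deriveE v df) (deriveE _ dg) deriveE; last first.
  exact: differentiable_comp.
by rewrite (diff_comp df dg).
Qed.

Lemma derive_delta {R : realType} {W : normedModType R} {m n : nat}
  (g : 'M[R]_(m, n) -> W) A B : differentiable g A ->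
  'D_B g A = \sum_i \sum_j B i j *: 'D_(delta_mx i j) g A.
Proof.
move=> dg; rewrite deriveE// {1}[B]matrix_sum_delta linear_sum.
apply: eq_bigr => i _; rewrite linear_sum; apply: eq_bigr => j _.
by rewrite linearZ deriveE.
Qed.

Lemma C1_mx {R : realType} {V : normedModType R} {m n : nat}
  (f : V -> 'M[R]_(m, n)) : (forall i j, C1 (fun y => f y i j)) -> C1 f.
Proof.
move=> f1; have df x : differentiable f x.
  by apply: differentiable_mx => i j; exact: (f1 i j).1.
split=> // v; apply: continuous_mx => i j.
rewrite (_ : (fun x => _) = 'D_v (fun y => f y i j)); first exact: (f1 i j).2.
by apply/funext => x; rewrite derive_coord.
Qed.

Lemma C1_coord {R : realType} {V : normedModType R} {m n : nat}
  (f : V -> 'M[R]_(m, n)) i j : C1 f -> C1 (fun y => f y i j).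
Proof.
move=> [df cf]; split=> [x|v]; first exact: differentiable_coord_comp.
rewrite (_ : 'D_v _ = (fun x => 'D_v f x i j)); last first.
  by apply/funext => x; rewrite derive_coord.
by move=> x; exact: (@continuous_coord_comp R V m n ('D_v f) x i j (cf v x)).
Qed.

Lemma C1_sum {R : realType} {V W : normedModType R} (I : Type) (r : seq I)
  (f : I -> V -> W) :
  (forall i, C1 (f i)) -> C1 (fun x => \sum_(i <- r) f i x).
Proof.
move=> f1; split=> [x|v]; first by apply: differentiable_sumr => i; exact: (f1 i).1.
rewrite (_ : 'D_v _ = (fun x => \sum_(i <- r) 'D_v (f i) x)).
  by apply: continuous_sumr => i; exact: (f1 i).2.
by apply/funext => x; rewrite derive_sumr// => i; exact: (f1 i).1.
Qed.

Lemma C1_continuous {R : realType} {V W : normedModType R} (f : V -> W) :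
  C1 f -> continuous f.
Proof. by move=> [df _] x; exact: differentiable_continuous. Qed.

Lemma C1M {R : realType} {V : normedModType R} (f g : V -> R) :
  C1 f -> C1 g -> C1 (fun x => f x * g x).
Proof.
move=> f1 g1; split=> [x|v]; first by apply: differentiableM; [exact: f1.1|exact: g1.1].
rewrite (_ : 'D_v _ = (fun x => f x * 'D_v g x + g x * 'D_v f x)); last first.
  apply/funext => x; rewrite (_ : (fun x => _) = f * g)// deriveM//.
    by apply: diff_derivable; exact: f1.1.
  by apply: diff_derivable; exact: g1.1.
move=> x; apply: cvgD; apply: cvgM.
- exact: (C1_continuous _ f1).
- exact: (g1.2 v x).
- exact: (C1_continuous _ g1).
- exact: (f1.2 v x).
Qed.

(** The direction ['D_v f x] moves with [x], whereas [C1 g] speaks of fixed directions only.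
    Expanding in the basis [delta_mx i j] leaves fixed directions with continuous coefficients. *)
Lemma C1_comp {R : realType} {V W : normedModType R} {m n : nat}
  (f : V -> 'M[R]_(m, n)) (g : 'M[R]_(m, n) -> W) :
  C1 f -> C1 g -> C1 (fun x => g (f x)).
Proof.
move=> f1 g1; split=> [x|v].
  by apply: differentiable_comp; [exact: f1.1|exact: g1.1].
rewrite (_ : 'D_v _ = (fun x => \sum_i \sum_j 'D_v f x i j *: 'D_(delta_mx i j) g (f x))).
  do 2!apply: continuous_sumr => ?; move=> x; apply: cvgZ.
    exact: (@continuous_coord_comp R V m n ('D_v f) x _ _ (f1.2 v x)).
  apply: (@continuous_comp _ _ _ f ('D_(delta_mx _ _) g)); last exact: g1.2.
  exact: C1_continuous.
apply/funext => x; rewrite (derive_comp _ _ _ _ (f1.1 x) (g1.1 (f x))).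
exact: derive_delta (g1.1 _).
Qed.

Lemma C1_mulmx {R : realType} {V : normedModType R} {m n p : nat}
  (f : V -> 'M[R]_(m, n)) (g : V -> 'M[R]_(n, p)) :
  C1 f -> C1 g -> C1 (fun x => f x *m g x).
Proof.
move=> f1 g1; apply: C1_mx => i k; under eq_fun do rewrite mxE.
by apply: C1_sum => j; apply: C1M; exact: C1_coord.
Qed.

(** The ball is compact, so the sum [D] of the norms of the partial derivatives is bounded on it; it
    is convex, so the mean value inequality along the segment from [y] to [x] stays inside. *)
Lemma C1_lipschitz_ball {R : realType} {n p : nat} (f : 'rV[R]_n -> 'rV[R]_p) :
  C1 f -> forall r, exists L, 0 <= L /\
  forall x y, `|x| <= r -> `|y| <= r -> `|f x - f y| <= L * `|x - y|.
Proof.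
move=> f1 r; pose B : set 'rV[R]_n := [set x | `|x| <= r].
have cB : compact B.
  apply: bounded_closed_compact.
    exists r; split; first exact: num_real.
    by move=> s rs x /= xr; exact: le_trans xr (ltW rs).
  rewrite (_ : B = closed_ball_ Num.norm 0 r); first exact: closed_closed_ball_.
  by rewrite /B /closed_ball_; apply/seteqP; split=> x /=; rewrite sub0r normrN.
pose D x := \sum_j `|'D_(delta_mx 0 j) f x|.
have cD : continuous D.
  apply: continuous_sumr => j x.
  by apply: (@continuous_comp _ _ _ ('D_(delta_mx 0 j) f) Num.norm);
    [exact: f1.2|exact: norm_continuous].
have [M [_ MD]] := compact_bounded (continuous_compact (continuous_subspaceT cD) cB).
(* Boundedness supplies a bound by every number strictly above [M], hence the added 1. *)
pose L := `|M| + 1.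
have DL x : B x -> D x <= L.
  move=> Bx; apply: le_trans (ler_norm _) _; apply: MD; last by exists x.
  by rewrite /L; have := ler_norm M; lra.
exists L; split=> [|x y xr yr]; first by rewrite /L addr_ge0.
pose g t := f (y + t *: (x - y)).
have inB t : 0 <= t <= 1 -> B (y + t *: (x - y)).
  move=> /andP[t0 t1]; rewrite /B /= (_ : _ + _ = (1 - t) *: y + t *: x).
    apply: le_trans (ler_normD _ _) _.
    rewrite !normrZ (ger0_norm t0) ger0_norm ?subr_ge0//.
    have : 0 <= (1 - t) * (r - `|y|) by rewrite mulr_ge0 ?subr_ge0.
    have : 0 <= t * (r - `|x|) by rewrite mulr_ge0 ?subr_ge0.
    lra.
  by rewrite scalerBl scale1r scalerBr addrA addrAC.
have dg t : is_derive t (1 : R) g ('D_(x - y) f (y + t *: (x - y))).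
  have dl : is_derive t (1 : R) (fun t : R => y + t *: (x - y)) (x - y).
    apply: (@is_derive1_quadratic _ _ _ _ 1 0) => // s _.
    by rewrite mul0r scalerBl opprD addrACA subrr add0r subrr normr0.
  have [dl1 dl2] := dl; have dl3 := (derivable1_diffP _ _).1 dl1.
  apply: DeriveDef; last by rewrite /g (derive_comp _ _ _ _ dl3 (f1.1 _)) dl2.
  by apply/derivable1_diffP; apply: differentiable_comp => //; exact: f1.1.
have := @mean_value_le R 1 p g _ 0 [set t : R | 0 <= t <= 1] (L * `|x - y|) 0 1.
rewrite /g scale0r scale1r addr0 subrKC scaler0 !subr0 normr1 mulr1; apply.
- by move=> a b /= ? ? z; lra.
- by rewrite /= lexx ler01.
- by rewrite /= lexx ler01.
- by rewrite mulr_ge0// addr_ge0.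
move=> t /inB/DL DLt; split; first exact: dg.
rewrite subr0 derive_delta; last exact: f1.1.
rewrite big_ord1; apply: (@le_trans _ _ (D (y + t *: (x - y)) * `|x - y|)); last first.
  by rewrite ler_wpM2r.
rewrite /D mulr_suml (le_trans (ler_norm_sum _ _ _))// ler_sum// => j _.
by rewrite normrZ mulrC ler_wpM2l// mx_coord_norm.
Qed.

(** * Ordinary differential equations *)

(** The integral from [a] has the right derivative only to the right of [a]; subtracting its value
    at 0 normalizes all these primitives alike. *)
Lemma primitive_right {R : realType} (g : R -> R) (a : R) : continuous g ->
  exists G : R -> R, G 0 = 0 /\ forall t, a < t -> is_derive t (1 : R) G (g t).
Proof.
move=> cg.
pose F x := (\int[@lebesgue_measure R]_(t in [set` `[a, x]]) g t)%R.
exists (fun x => F x - F 0); split=> [|t at_]; first by rewrite subrr.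
have gi : (@lebesgue_measure R).-integrable `[a, t + 1] (EFin \o g).
  apply: continuous_compact_integrable; first exact: segment_compact.
  exact: continuous_subspaceT.
have [|Fd F'] := @continuous_FTC1_closed R g a t (t + 1) _ gi at_ (cg t).
  by rewrite ltrDl.
rewrite -[g t]subr0; apply: is_deriveB.
by apply: DeriveDef => //; rewrite -derive1E.
Qed.

(** Two normalized primitives with negative lower endpoints agree where both are valid: they have
    the same derivative and both vanish at 0. They therefore glue over the whole line. *)
Lemma exists_primitive {R : realType} (g : R -> R) : continuous g ->
  exists G : R -> R, G 0 = 0 /\ forall t, is_derive t (1 : R) G (g t).
Proof.
move=> cg; have /choice[P HP] := fun a => @primitive_right R g a cg.
have PE a b t : a < t -> a < 0 -> b < t -> b < 0 -> P a t = P b t.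
  move=> at_ a0 bt b0; have [Pa0 Pad] := HP a; have [Pb0 Pbd] := HP b.
  suff : P a 0 - P b 0 = P a t - P b t.
    by rewrite Pa0 Pb0 subrr => /esym/eqP; rewrite subr_eq0 => /eqP.
  apply: (mean_value_cstr (fun s => P a s - P b s) [set s | (a < s) && (b < s)]).
  - by move=> x y /andP[? ?] /andP[? ?] z /andP[? ?]; apply/andP; split; lra.
  - by rewrite /= a0.
  - by rewrite /= at_.
  move=> s /andP[as_ bs]; rewrite -[0](subrr (g s)).
  by apply: is_deriveB; [exact: Pad|exact: Pbd].
(* The lower endpoint depends on [t]. For all [s] within 1 of [t] the single endpoint [- (|t| + 2)]
   serves instead, by [PE], and this gives the derivative at [t]. *)
exists (fun t => P (- (`|t| + 1)) t); split=> [|t]; first exact: (HP _).1.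
apply: (@near_eq_is_derive _ _ _ (P (- (`|t| + 2)))).
  near=> s; have st : `|t - s| < 1 by near: s; exact: cvgr_dist_lt.
  have := ler_norm t; have := ler_norm (- t); have := ler_norm s.
  have := ler_norm (- s); have := ler_distD s t 0; have := ler_distD t s 0.
  rewrite !subr0 (distrC s t) !normrN => ? ? ? ? ? ?.
  by apply: PE; lra.
by apply: (HP _).2; have := ler_norm (- t); rewrite normrN; lra.
Unshelve. all: by end_near. Qed.

Lemma exists_primitive_mx {R : realType} {m n : nat} (g : R -> 'M[R]_(m, n)) :
  continuous g ->
  exists G : R -> 'M[R]_(m, n), G 0 = 0 /\ forall t, is_derive t (1 : R) G (g t).
Proof.
move=> cg.
have /choice[P HP] : forall ij : 'I_m * 'I_n, exists G : R -> R,
    G 0 = 0 /\ forall t, is_derive t (1 : R) G (g t ij.1 ij.2).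
  move=> [i j]; apply: (@exists_primitive R (fun t => g t i j)) => t.
  exact: (@continuous_coord_comp R R m n g t i j (cg t)).
exists (fun t => \matrix_(i, j) P (i, j) t); split=> [|t].
  by apply/matrixP => i j; rewrite !mxE; exact: (HP (i, j)).1.
apply: is_derive_mx => i j; under eq_fun do rewrite mxE.
exact: (HP (i, j)).2.
Qed.

(** Multiplied by [expR (- K * t)], [phi] becomes nonincreasing, which settles the times after [a];
    multiplied by [expR (K * t)] it becomes nondecreasing, which settles those before. *)
Lemma gronwall_eq0 {R : realType} (phi dphi : R -> R) (A : set R) (K a b : R) :
  is_interval A -> A a -> A b -> phi a = 0 ->
  (forall t, A t -> is_derive t (1 : R) phi (dphi t) /\ `|dphi t| <= K * phi t) ->
  phi b <= 0.
Proof.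
move=> iA Aa Ab a0 dphiK.
pose psi k t := phi t * expR (k * t).
have dpsi k t : A t ->
    is_derive t (1 : R) (psi k) ((dphi t + k * phi t) * expR (k * t)).
  move=> /dphiK[dt _].
  have de : is_derive t (1 : R) (fun s => expR (k * s)) (k * expR (k * t)).
    apply: is_derive_eq; rewrite /GRing.scale /=; ring.
  apply: is_derive_eq (is_deriveM dt de) _.
  by rewrite /GRing.scale /=; ring.
have mvt k c d : A c -> A d -> c <= d -> exists t,
    A t /\ psi k d - psi k c = (dphi t + k * phi t) * expR (k * t) * (d - c).
  move=> Ac Ad cd.
  have [||t tcd ->] := @MVT_segment R (psi k)
    (fun t => (dphi t + k * phi t) * expR (k * t)) _ _ cd.
  - by move=> t tcd; apply/dpsi/(is_interval_itv _ _ _ iA Ac Ad); exact: subset_itv_oo_cc.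
  - apply: continuous_in_subspaceT => t; rewrite inE => tcd.
    by apply/is_derive1_continuous/dpsi/(is_interval_itv _ _ _ iA Ac Ad).
  by exists t; split=> //; exact: (is_interval_itv _ _ _ iA Ac Ad).
have psi_le k : psi k b <= 0 -> phi b <= 0.
  by rewrite /psi pmulr_lle0 ?expR_gt0.
have psia k : psi k a = 0 by rewrite /psi a0 mul0r.
have [ab|/ltW ba] := leP a b.
  apply: (psi_le (- K)); have [t [At E]] := mvt (- K) a b Aa Ab ab.
  move: E; rewrite psia subr0 => ->; rewrite mulr_le0_ge0 ?subr_ge0//.
  rewrite mulr_le0_ge0 ?expR_ge0//.
  by have := ler_norm (dphi t); have [_] := dphiK _ At; lra.
apply: (psi_le K); have [t [At E]] := mvt K b a Ab Aa ba.
rewrite -oppr_ge0; move: E; rewrite psia sub0r => ->.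
rewrite !mulr_ge0 ?expR_ge0 ?subr_ge0//.
by have := ler_norm (- dphi t); rewrite normrN; have [_] := dphiK _ At; lra.
Qed.

Lemma bounded_on_segment {R : realType} {V : normedModType R} (g : R -> V) (a b : R) :
  {in `[a, b], forall t, {for t, continuous g}} ->
  exists M, {in `[a, b], forall t, `|g t| <= M}.
Proof.
move=> cg.
have cgs : {within `[a, b], continuous g}.
  by apply: continuous_in_subspaceT => t; rewrite inE; exact: cg.
have [M [_ MP]] := compact_bounded (continuous_compact cgs (@segment_compact _ a b)).
exists (`|M| + 1) => t tab; apply: MP; last by exists t.
by have := ler_norm M; lra.
Qed.

Section ODE.
Context {R : realType} {n : nat} (F : 'rV[R]_n -> 'rV[R]_n) (F1 : C1 F).

(* Picard iteration on [|t| <= d], where the iterates contract by 1/2 because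
   [d * L <= 1/2] for a Lipschitz constant [L] of [F]. *)
Lemma picard_local (x0 : 'rV[R]_n) : exists d (y : R -> 'rV[R]_n),
  [/\ 0 < d, y 0 = x0 & forall t, `|t| < d -> is_derive t (1 : R) y (F (y t))].
Proof.
(* The iterates will stay within 1 of [x0] and their limit within 2, so [F] is evaluated only in the
   ball of radius [r] about 0. There [L] is a Lipschitz constant, and [B] bounds [F] within 2 of
   [x0]. *)
pose r := `|x0| + 2.
have ball_r x : `|x - x0| <= 2 -> `|x| <= r.
  by have := ler_distD x0 x 0; rewrite !subr0 /r; lra.
have [L [L0 FL]] := C1_lipschitz_ball _ F1 r.
pose B := `|F x0| + 2 * L.
have B0 : 0 <= B by rewrite addr_ge0// mulr_ge0.
have FB x : `|x - x0| <= 2 -> `|F x| <= B.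
  move=> xx0; have := ler_distD (F x0) (F x) 0; rewrite !subr0.
  have /FL/(_ _)/= := ball_r _ xx0.
  move=> /(_ x0 (ball_r _ _)); rewrite subrr normr0 => /(_ (ler0n _ _)).
  have : L * `|x - x0| <= L * 2 by rewrite ler_wpM2l.
  rewrite /B; lra.
(* The primitive is made a total operator so that it can be iterated. Its value at a discontinuous
   [g] is arbitrary and is never met, as all iterates are continuous ([cy]). *)
have /choice[P HP] : forall g : R -> 'rV[R]_n, exists G : R -> 'rV[R]_n,
    continuous g -> G 0 = 0 /\ forall t, is_derive t (1 : R) G (g t).
  move=> g; have [/exists_primitive_mx[G HG]|ncg] := pselect (continuous g).
    by exists G.
  by exists g.
pose y k := iter k (fun z : R -> 'rV[R]_n => fun t => x0 + P (F \o z) t) (cst x0).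
have cF := C1_continuous _ F1.
have yS k : continuous (y k) -> y k.+1 0 = x0 /\
    forall t, is_derive t (1 : R) (y k.+1) (F (y k t)).
  move=> cy; have [|P0 Pd] := HP (F \o y k).
    by move=> t; apply: (@continuous_comp _ _ _ (y k) F); [exact: cy|exact: cF].
  split=> [|t]; first by rewrite /y /= P0 addr0.
  rewrite -[F _]add0r; exact: (is_deriveD (is_derive_cst x0 t 1) (Pd t)).
have cy k : continuous (y k).
  elim: k => [|k /yS[_ H] t]; first exact: cst_continuous.
  exact: is_derive1_continuous (H t).
have y0 k : y k 0 = x0 by case: k => [|k] //; exact: (yS k (cy k)).1.
have yd k t : is_derive t (1 : R) (y k.+1) (F (y k t)) := (yS k (cy k)).2 t.
(* This gives [d * L <= 1/2] for the contraction and [d * B <= 1] to keep the iterates near [x0];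
   the 1 keeps the denominator positive. *)
pose d := (2 * (L + B + 1))^-1.
have d0 : 0 < d by rewrite invr_gt0; lra.
have dE : d * (L + B + 1) = 2^-1 by rewrite /d; field; lra.
have iD (e : R) : is_interval [set t : R | `|t| <= e].
  move=> a b /=; rewrite !ler_norml => /andP[? ?] /andP[? ?] z /andP[? ?].
  by rewrite ler_norml; apply/andP; split; lra.
have D0 : `|0 : R| <= d by rewrite normr0 ltW.
have yball k t : `|t| <= d -> `|y k t - x0| <= 1.
  elim: k t => [|k IH] t td; first by rewrite /y /= subrr normr0.
  have := @mean_value_le R 1 n (y k.+1) _ 0 _ B 0 t (iD d) D0 td B0.
  rewrite y0 scaler0 !subr0 => H.
  have {}H : `|y k.+1 t - x0| <= B * `|t|.
    apply: H => s sd; split; first exact: yd.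
    by rewrite subr0; apply: FB; have := IH _ sd; lra.
  have : B * `|t| <= B * d by rewrite ler_wpM2l.
  have : 0 <= d * L by rewrite mulr_ge0// ltW.
  lra.
have ystep k t : `|t| <= d -> `|y k.+1 t - y k t| <= 1 * 2^-1 ^+ k.
  elim: k t => [|k IH] t td; first by rewrite expr0 mulr1 (yball 1%N).
  have K0 : 0 <= L * 2^-1 ^+ k by rewrite mulr_ge0// exprn_ge0.
  have := @mean_value_le R 1 n (fun s => y k.+2 s - y k.+1 s)
    (fun s => F (y k.+1 s) - F (y k s)) 0 _ (L * 2^-1 ^+ k) 0 t (iD d) D0 td K0.
  rewrite !y0 subrr scaler0 !subr0 => H.
  have {}H : `|y k.+2 t - y k.+1 t| <= L * 2^-1 ^+ k * `|t|.
    apply: H => s sd; split; first by apply: is_deriveB; exact: yd.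
    have sr i : `|y i s| <= r by apply: ball_r; have := yball i s sd; lra.
    rewrite subr0 (le_trans (FL _ _ (sr _) (sr _)))// ler_wpM2l//.
    by have := IH s sd; rewrite mul1r.
  rewrite exprS mul1r; apply: (le_trans H).
  rewrite mulrAC ler_wpM2r ?exprn_ge0//.
  have : L * `|t| <= L * d by rewrite ler_wpM2l.
  have : 0 <= d * B by rewrite mulr_ge0// ltW.
  lra.
have /choice[z zlim] : forall t, exists l, `|t| <= d ->
    forall k, `|y k t - l| <= 2 * 2^-1 ^+ k.
  move=> t; have [td|_] := leP `|t| d; last by exists 0.
  have [l Hl] := cvg_half_steps (fun k => y k t) 1 (fun k => ystep k t td).
  by exists l => _ k; have := Hl k; rewrite mulr1.
have zball t : `|t| <= d -> `|z t - x0| <= 2.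
  by move=> /zlim/(_ 0%N); rewrite expr0 mulr1 /y /= distrC.
have ylip k s t : `|s| <= d -> `|t| <= d -> `|y k t - y k s| <= B * `|t - s|.
  move=> sd td; case: k => [|k]; first by rewrite /y /= subrr normr0 mulr_ge0.
  have := @mean_value_le R 1 n (y k.+1) _ 0 _ B s t (iD d) sd td B0.
  rewrite scaler0 !subr0; apply=> w wd; split; first exact: yd.
  by rewrite subr0; apply: FB; have := yball k w wd; lra.
(* The limit [z] is shown to solve the equation through this expansion: on the segment from [s] to
   [t] the velocity [F (y k w)] of the next iterate differs from [F (z s)] by at most
   [L * (B * |t - s| + 2 * 2^-k)]. *)
have zquad s t : `|s| <= d -> `|t| <= d ->
    `|z t - z s - (t - s) *: F (z s)| <= L * B * `|t - s| ^+ 2.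
  move=> sd td.
  have zk w k : `|w| <= d -> `|y k.+1 w - z w| <= 2^-1 ^+ k.
    by move=> /zlim/(_ k.+1); rewrite exprS mulrA mulfV ?mul1r.
  (* The 2 pays for replacing [z] by [y k.+1] at both ends, the other term for replacing [z s] by
     [y k s] inside [F]. *)
  apply: (@ler_add_half _ _ _ (2 + 2 * L * `|t - s|)) => k.
  have K0 : 0 <= L * (B * `|t - s| + 2 * 2^-1 ^+ k).
    by rewrite mulr_ge0// addr_ge0// mulr_ge0// exprn_ge0.
  have iA : is_interval [set w : R | `|w| <= d /\ `|w - s| <= `|t - s|].
    move=> a b /= [ad as_] [bd bs] w /andP[aw wb]; split.
      by apply: (iD d a b ad bd w); rewrite aw.
    move: as_ bs; rewrite !ler_norml => /andP[? ?] /andP[? ?].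
    by apply/andP; split; lra.
  have := @mean_value_le R 1 n (y k.+1) (fun w => F (y k w)) (F (z s)) _
    (L * (B * `|t - s| + 2 * 2^-1 ^+ k)) s t iA.
  rewrite /= subrr normr0 normr_ge0 lexx => /(_ (conj sd isT) (conj td isT) K0) H.
  have {}H : `|y k.+1 t - y k.+1 s - (t - s) *: F (z s)| <=
      L * (B * `|t - s| + 2 * 2^-1 ^+ k) * `|t - s|.
    apply: H => w [wd ws]; split; first exact: yd.
    apply: le_trans (FL _ _ _ _) _.
    - by apply: ball_r; have := yball k w wd; lra.
    - exact/ball_r/zball.
    rewrite ler_wpM2l// -(subrKA (y k s)); apply: le_trans (ler_normD _ _) _.
    rewrite lerD//; last exact: zlim.
    by rewrite (le_trans (ylip _ _ _ sd wd))// ler_wpM2l.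
  have zt := zk t k td; have zs := zk s k sd.
  rewrite (_ : _ - _ - _ = (y k.+1 t - y k.+1 s - (t - s) *: F (z s))
    + ((y k.+1 s - z s) - (y k.+1 t - z t))); last first.
    by apply/rowP => i; rewrite !mxE; ring.
  apply: le_trans (ler_normD _ _) _; apply: le_trans (lerD H (ler_normB _ _)) _.
  rewrite expr2; move: zt zs; move: (2^-1 ^+ k) => q zt zs.
  lra.
exists d, z; split=> // [|t td].
  have := zlim 0; rewrite D0 => /(_ isT) H; apply/eqP; rewrite -subr_eq0 -normr_le0.
  rewrite distrC; apply: (@ler_add_half _ _ _ 2) => k.
  by rewrite add0r -{1}(y0 k).
apply: (@is_derive1_quadratic _ _ _ _ (d - `|t|) (L * B)).
  by rewrite subr_gt0.
move=> s st; apply: zquad; first exact: ltW.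
have := ler_normD (s - t) t; rewrite subrK; lra.
Qed.

(** Both curves are bounded on the segment between [a] and [b], so one Lipschitz constant of [F]
    serves there, and Gronwall applies to their distance. *)
Lemma solution_unique (I : set R) (g1 g2 : R -> 'rV[R]_n) (a b : R) :
  is_interval I -> I a -> I b -> g1 a = g2 a ->
  (forall t, I t -> is_derive t (1 : R) g1 (F (g1 t))) ->
  (forall t, I t -> is_derive t (1 : R) g2 (F (g2 t))) -> g1 b = g2 b.
Proof.
move=> iI Ia Ib g12 d1 d2.
pose S : set R := [set` `[Num.min a b, Num.max a b]].
have iS : is_interval S by exact: interval_is_interval.
have Sa : S a by rewrite /S /= in_itv /= ge_min le_max lexx.
have Sb : S b by rewrite /S /= in_itv /= ge_min le_max lexx !orbT.
have SI t : S t -> I t.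
  have Im : I (Num.min a b) by case: leP.
  have IM : I (Num.max a b) by case: leP.
  exact: (is_interval_itv _ _ _ iI Im IM).
have [M1 HM1] := @bounded_on_segment R _ g1 _ _
  (fun t St => is_derive1_continuous _ _ _ (d1 t (SI t St))).
have [M2 HM2] := @bounded_on_segment R _ g2 _ _
  (fun t St => is_derive1_continuous _ _ _ (d2 t (SI t St))).
have [L [L0 FL]] := C1_lipschitz_ball _ F1 (Num.max M1 M2).
pose w t := g1 t - g2 t.
(* The squared Euclidean distance is used because the sup norm is not differentiable; each of its
   [n] terms contributes [2 * L * phi] to the Gronwall constant. *)
pose phi t := \sum_j w t 0 j ^+ 2.
have wphi t : `|w t| ^+ 2 <= phi t.
  have phi0 : 0 <= phi t by apply: sumr_ge0 => j _; exact: sqr_ge0.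
  rewrite -(sqr_sqrtr phi0) lerXn2r ?nnegrE// ?sqrtr_ge0//.
  apply: mx_norm_le => [|i j]; first exact: sqrtr_ge0.
  rewrite ord1 -sqrtr_sqr ler_sqrt// /phi (bigD1 j)//= lerDl.
  by apply: sumr_ge0 => k _; exact: sqr_ge0.
have dw t j : S t -> is_derive t (1 : R) (fun s => w s 0 j)
    ((F (g1 t) - F (g2 t)) 0 j).
  by move=> /SI It; apply: is_derive_coord; apply: is_deriveB; [exact: d1|exact: d2].
have dphi t : S t -> is_derive t (1 : R) phi
    (\sum_j 2 * w t 0 j * (F (g1 t) - F (g2 t)) 0 j).
  move=> St; rewrite /phi (_ : (fun _ => _) = \sum_j (fun s => w s 0 j ^+ 2)).
    apply: is_derive_sum => j; have := dw t j St => H.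
    apply: is_derive_eq; rewrite /GRing.scale/=; ring.
  by apply/funext => s; rewrite fct_sumE.
have := @gronwall_eq0 R phi _ S (2 * n%:R * L) a b iS Sa Sb.
have -> : phi a = 0.
  by rewrite /phi big1// => j _; rewrite /w g12 subrr mxE expr0n.
move=> /(_ _ erefl) phib.
apply/eqP; rewrite -subr_eq0 -normr_le0 -(@ler_pXn2r _ 2)// ?nnegrE// expr0n.
apply: (le_trans (wphi b)); apply: phib => t St; split; first exact: dphi.
apply: le_trans (ler_norm_sum _ _ _) _.
have wL j : `|2 * w t 0 j * (F (g1 t) - F (g2 t)) 0 j| <= 2 * L * phi t.
  rewrite !normrM (ger0_norm (ler0n _ _)) -!mulrA ler_wpM2l//.
  have r1 : `|g1 t| <= Num.max M1 M2 by rewrite le_max (HM1 t St).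
  have r2 : `|g2 t| <= Num.max M1 M2 by rewrite le_max (HM2 t St) orbT.
  apply: (@le_trans _ _ (`|w t| * (L * `|w t|))).
    apply: ler_pM => //; first exact: mx_coord_norm.
    by rewrite (le_trans (mx_coord_norm _ _ _))// FL.
  by rewrite mulrCA -expr2 ler_wpM2l.
apply: le_trans (ler_sum _ (fun j _ => wL j)) _.
by rewrite sumr_const card_ord -mulr_natr; lra.
Qed.

Definition curve_in (A : set 'rV[R]_n) (x : 'rV[R]_n) (I : set R)
    (g : R -> 'rV[R]_n) :=
  [/\ open I, is_interval I, I 0, g 0 = x & integral_curve F A I g].

Lemma curve_in_eq A x I1 I2 g1 g2 t :
  curve_in A x I1 g1 -> curve_in A x I2 g2 -> I1 t -> I2 t -> g1 t = g2 t.
Proof.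
move=> [_ i1 I10 g10 c1] [_ i2 I20 g20 c2] I1t I2t.
apply: (@solution_unique (I1 `&` I2) g1 g2 0 t) => //; first exact: is_intervalI.
- by rewrite g10.
- by move=> s [/c1[]].
- by move=> s [_ /c2[]].
Qed.

(** By continuity the Picard solution stays in the open set [A] for a short time; the interval is
    shrunk accordingly. *)
Lemma curve_in_local A x : open A -> A x -> exists I g, curve_in A x I g.
Proof.
move=> oA Ax; have [d [y [d0 y0 yd]]] := picard_local x.
have y0d : `|0 : R| < d by rewrite normr0.
have /nbhs_ballP[e /= e0 eA] : \forall t \near 0, A (y t).
  apply: (is_derive1_continuous _ _ _ (yd 0 y0d)).
  by rewrite y0; exact: open_nbhs_nbhs.
pose m := Num.min d e.
have m0 : 0 < m by rewrite lt_min d0.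
exists (ball 0 m), y; split=> //.
- exact: ball_open.
- move=> s t; rewrite -ball_normE /= !sub0r !normrN !ltr_norml => /andP[? ?].
  move=> /andP[? ?] z /andP[? ?]; rewrite sub0r normrN ltr_norml.
  by apply/andP; split; lra.
- exact: ballxx.
move=> t tm; split.
  by apply: eA; apply: le_ball tm; rewrite ge_min lexx orbT.
apply: yd; move: tm; rewrite -ball_normE /= sub0r normrN => /lt_le_trans; apply.
by rewrite ge_min lexx.
Qed.

(* The interval of existence is the union of the domains of all integral curves
   through [x]; by uniqueness they glue to the maximal one. *)
Lemma flow_exists A : open A -> exists J Phi, flow F A J Phi.
Proof.
move=> oA.
pose J x := [set t | exists I g, curve_in A x I g /\ I t].
(* The value does not depend on the chosen curve, by [curve_in_eq]; off the domain it is 0. *)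
have /choice[Psi HPsi] : forall tx : R * 'rV[R]_n, exists z, forall I g,
    curve_in A tx.2 I g -> I tx.1 -> z = g tx.1.
  move=> [t x]; have [[I [g [c It]]]|N] := pselect (J x t).
    by exists (g t) => I' g' c' I't; exact: curve_in_eq c c' It I't.
  by exists 0 => I g c It; case: N; exists I, g.
pose Phi t x := Psi (t, x).
have PhiE x I g t : curve_in A x I g -> I t -> Phi t x = g t.
  by move=> c It; exact: (HPsi (t, x) I g c It).
exists J, Phi => x Ax; have [I0 [g0 c0]] := curve_in_local A x oA Ax.
have [_ _ I00 g00 _] := c0.
split.
- split; last by exists I0, g0.
    rewrite openE => t [I [g [c It]]]; have [oI _ _ _ _] := c.
    by apply: (filterS _ (open_nbhs_nbhs (conj oI It))) => s Is; exists I, g.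
  move=> s t [I [g [c Is]]] [I' [g' [c' I't]]] z /andP[sz zt].
  have [_ iI I_0 _ _] := c; have [_ iI' I'_0 _ _] := c'.
  (* Every domain contains 0, so [z] lies in that of the curve reaching [s] or of the one reaching
     [t], according to its sign. *)
  have [z0|/ltW z0] := leP z 0.
    by exists I, g; split=> //; apply: (iI s 0) => //; rewrite sz.
  by exists I', g'; split=> //; apply: (iI' 0 t) => //; rewrite z0.
- by rewrite (PhiE _ _ _ _ c0).
- move=> t [I [g [c It]]]; have [oI _ _ _ icg] := c.
  rewrite (PhiE _ _ _ _ c It); have [Ag dg] := icg t It; split=> //.
  apply: near_eq_is_derive dg.
  apply: (filterS _ (open_nbhs_nbhs (conj oI It))) => s Is.
  by rewrite (PhiE _ _ _ _ c Is).
move=> I g oI iI I_0 g_0 cg.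
have c : curve_in A x I g by [].
by split=> t It; [exists I, g|rewrite (PhiE _ _ _ _ c It)].
Qed.
End ODE.

(** * Orthogonal projections of constant rank *)

(** The first-order expansion of [f] at [x] is also one of [g]. This is needed because the explicit
    formula for the vertical component holds only locally. *)
Lemma near_eq_differentiable {R : realType} {V W : normedModType R}
  (f g : V -> W) x :
  (\near x, f x = g x) -> differentiable f x -> differentiable g x.
Proof.
move=> fg /diff_locallyP[cdf fE].
have gE : g \o shift x = cst (g x) + 'd f x +o_ 0 id.
  apply/eqaddoP => e e0; move/eqaddoP : fE => /(_ e e0) fE; near=> h.
  have : `|(f \o shift x - (cst (f x) + 'd f x)) h| <= e * `|id h|.
    by near: h.
  rewrite !fctE /= (nbhs_singleton fg).
  suff -> : f (h + x) = g (h + x) by [].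
  near: h; have := fg; rewrite (near_shift 0 x)/=.
  by apply: filterS => h; rewrite /= subr0.
apply/diff_locallyP; have -> : 'd g x = 'd f x :> (V -> W) by exact: diff_unique.
by [].
Unshelve. all: by end_near. Qed.

Lemma differentiable_prodr {R : realType} {V : normedModType R}
  (I : Type) (r : seq I) (f : I -> V -> R) x :
  (forall i, differentiable (f i) x) ->
  differentiable (fun y => \prod_(i <- r) f i y) x.
Proof.
move=> df; elim: r => [|i r IH].
  by under eq_fun do rewrite big_nil; exact: differentiable_cst.
under eq_fun do rewrite big_cons.
by apply: differentiableM; [exact: df|exact: IH].
Qed.

Lemma differentiable_mulmx {R : realType} {V : normedModType R} {m n p : nat}
  (f : V -> 'M[R]_(m, n)) (g : V -> 'M[R]_(n, p)) x :
  differentiable f x -> differentiable g x ->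
  differentiable (fun y => f y *m g y) x.
Proof.
move=> df dg; apply: differentiable_mx => i k; under eq_fun do rewrite mxE.
by apply: differentiable_sumr => j; apply: differentiableM;
  exact: differentiable_coord_comp.
Qed.

Lemma differentiable_trmx {R : realType} {V : normedModType R} {m n : nat}
  (f : V -> 'M[R]_(m, n)) x :
  differentiable f x -> differentiable (fun y => (f y)^T) x.
Proof.
move=> df; apply: differentiable_mx => i k; under eq_fun do rewrite mxE.
exact: differentiable_coord_comp.
Qed.

Lemma differentiable_scalemx {R : realType} {V : normedModType R} {m n : nat}
  (k : V -> R) (f : V -> 'M[R]_(m, n)) x :
  differentiable k x -> differentiable f x ->
  differentiable (fun y => k y *: f y) x.
Proof.
move=> dk df; apply: differentiable_mx => i j; under eq_fun do rewrite mxE.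
by apply: differentiableM => //; exact: differentiable_coord_comp.
Qed.

Lemma differentiable_det {R : realType} {V : normedModType R} {m : nat}
  (f : V -> 'M[R]_m) x :
  differentiable f x -> differentiable (fun y => \det (f y)) x.
Proof.
move=> df; rewrite /determinant; apply: differentiable_sumr => s.
apply: differentiableM; first exact: differentiable_cst.
by apply: differentiable_prodr => i; exact: differentiable_coord_comp.
Qed.

Lemma differentiable_adjugate {R : realType} {V : normedModType R} {m : nat}
  (f : V -> 'M[R]_m) x :
  differentiable f x -> differentiable (fun y => \adj (f y)) x.
Proof.
move=> df; apply: differentiable_mx => i j; under eq_fun do rewrite mxE.
rewrite /cofactor; apply: differentiableM; first exact: differentiable_cst.
apply: differentiable_det; apply: differentiable_mx => k l.
by under eq_fun do rewrite !mxE; exact: differentiable_coord_comp.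
Qed.

(** The diagonal entries of [A *m A^T] are sums of squares of the rows of [A]. *)
Lemma mulmx_tr_eq0 {R : realType} {m n : nat} (A : 'M[R]_(m, n)) :
  A *m A^T = 0 -> A = 0.
Proof.
move=> A0; apply/matrixP => i j; apply/eqP; rewrite mxE.
have /eqP := congr1 (fun B : 'M[R]_m => B i i) A0; rewrite !mxE.
rewrite psumr_eq0 => [/allP/(_ j)|k _]; last by rewrite mxE -expr2 sqr_ge0.
by rewrite mem_index_enum mxE mulf_eq0 orbb; apply.
Qed.

(** If [U] annihilates the Gram matrix, then [U *m C] times its transpose vanishes, so [U *m C = 0],
    and independent rows force [U = 0]. *)
Lemma gram_unit {R : realType} {m n : nat} (C : 'M[R]_(m, n)) :
  (C *m C^T \in unitmx) = row_free C.
Proof.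
rewrite -row_free_unit; apply/idP/idP => [|Cf].
  rewrite /row_free => /eqP Cm; rewrite eqn_leq rank_leq_row -{1}Cm.
  exact: mxrankM_maxl.
rewrite -kermx_eq0; set U := kermx _.
have U0 : U *m (C *m C^T) = 0 by exact/sub_kermxP.
rewrite -(mulmx_free_eq0 _ Cf); apply/eqP/mulmx_tr_eq0.
by rewrite trmx_mul !mulmxA -(mulmxA U) U0 mul0mx.
Qed.

Section OrthogonalSplit.
Context {R : realType}.

Lemma orth_cap0 {m p : nat} (K : 'M[R]_(p, m)) : (<<K>> :&: kermx K^T)%MS = 0.
Proof.
apply/eqP; rewrite -submx0; set W := (_ :&: _)%MS.
suff -> : W = 0 by [].
have /submxP[D WD] : (W <= K)%MS by rewrite (submx_trans (capmxSl _ _))// genmxE.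
have /sub_kermxP WK : (W <= kermx K^T)%MS := capmxSr _ _.
by apply: mulmx_tr_eq0; rewrite {2}WD trmx_mul mulmxA WK mul0mx.
Qed.

Lemma orth_full {m p : nat} (K : 'M[R]_(p, m)) : row_full (<<K>> + kermx K^T)%MS.
Proof.
rewrite /row_full mxrank_disjoint_sum ?orth_cap0// mxrank_ker mxrank_tr genmxE.
by rewrite subnKC// rank_leq_col.
Qed.

(** The range of [X] is the orthogonal complement of the null space of its transpose: one inclusion
    is immediate and the ranks agree. *)
Lemma kermx_tr_kermx {N n : nat} (X : 'M[R]_(N, n)) :
  (kermx (kermx X)^T :=: X^T)%MS.
Proof.
have XK : (X^T <= kermx (kermx X)^T)%MS.
  by apply/sub_kermxP; rewrite -trmx_mul mulmx_ker trmx0.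
apply/eqmxP; rewrite XK andbT -(mxrank_leqif_sup XK).
by rewrite mxrank_ker !mxrank_tr mxrank_ker subKn// rank_leq_row.
Qed.

(** This is [perp X] applied to [w], written for row vectors. *)
Definition vertical {N n : nat} (X : 'M[R]_(N, n)) (w : 'rV[R]_N) : 'rV[R]_N :=
  w *m orth_proj (kermx X).

Context {N n : nat} (X : 'M[R]_(N, n)).
Implicit Types w a b : 'rV[R]_N.

Lemma vertical_ker w : (vertical X w <= kermx X)%MS.
Proof. by rewrite (submx_trans (proj_mx_sub _ _ _))// genmxE. Qed.

Lemma vertical_range w : (w - vertical X w <= X^T)%MS.
Proof.
by rewrite -kermx_tr_kermx proj_mx_compl_sub// submx_full// orth_full.
Qed.

Lemma verticalK b : (b <= kermx X)%MS -> vertical X b = b.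
Proof. by move=> bK; apply: proj_mx_id; rewrite ?orth_cap0// genmxE. Qed.

Lemma vertical0 a : (a <= X^T)%MS -> vertical X a = 0.
Proof. by move=> aX; apply: proj_mx_0; rewrite ?orth_cap0// kermx_tr_kermx. Qed.

(** Uniqueness of the orthogonal decomposition; it identifies an explicit candidate with the
    projection. *)
Lemma vertical_eq w b : (w - b <= X^T)%MS -> (b <= kermx X)%MS ->
  vertical X w = b.
Proof.
move=> /vertical0 wb /verticalK bK; rewrite -[w](subrK b).
by rewrite /vertical mulmxDl -!/(vertical _ _) wb add0r.
Qed.

Lemma range_ker_ip a b : (a <= X^T)%MS -> (b <= kermx X)%MS -> mxip a b = 0.
Proof.
move=> /submxP[D ->] /sub_kermxP bX; rewrite /mxip big_ord1.
transitivity ((D *m X^T *m b^T) 0 0); last first.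
  by rewrite -mulmxA -trmx_mul bX trmx0 mulmx0 mxE.
by rewrite mxE; apply: eq_bigr => j _; rewrite [b^T _ _]mxE.
Qed.

Lemma range_ker_eq0 a b : (a <= X^T)%MS -> (b <= kermx X)%MS -> a + b = 0 ->
  a = 0 /\ b = 0.
Proof.
move=> aX bX ab; have b0 : b = 0.
  by rewrite -(verticalK b bX) -[b](addKr a) ab addr0 vertical0// eqmx_opp.
by move: ab; rewrite b0 addr0.
Qed.
End OrthogonalSplit.

(* If [C y] consists of [\rank (M x)] rows spanning the range of [M y], then
   the vertical component of [e y] is [e - e C^T (C C^T)^-1 C], with the inverse
   given by Cramer's rule. *)
Lemma differentiable_vertical {R : realType} {V : normedModType R} {N n : nat}
    (M : V -> 'M[R]_(N, n)) (e : V -> 'rV[R]_N) (x : V) :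
  differentiable M x -> differentiable e x ->
  (\forall y \near x, \rank (M y) = \rank (M x)) ->
  differentiable (fun y => vertical (M y) (e y)) x.
Proof.
move=> dM de rM.
(* With [S] fixed, [M y *m S] is as smooth as [M], and at [y = x] it equals [col_base (M x)], whose
   columns are independent. *)
pose S := pinvmx (row_base (M x)).
pose C y := (M y *m S)^T.
pose G y := C y *m (C y)^T.
have dC : differentiable C x.
  by apply: differentiable_trmx; apply: differentiable_mulmx.
have dCT : differentiable (fun y => (C y)^T) x by exact: differentiable_trmx.
have dG : differentiable G x by exact: differentiable_mulmx.
have Gx : \det (G x) != 0.
  have MS : M x *m S = col_base (M x).
    by rewrite -[X in X *m _](mulmx_base (M x)) -mulmxA mulmxVp ?mulmx1// row_base_free.
  rewrite -unitfE -unitmxE gram_unit /C MS /row_free mxrank_tr.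
  by have := col_base_full (M x); rewrite /row_full.
have dd : differentiable (fun y => \det (G y)) x by exact: differentiable_det.
pose w y := e y - (\det (G y))^-1 *: (e y *m (C y)^T *m \adj (G y) *m C y).
apply: (@near_eq_differentiable _ _ _ w).
  near=> y; apply/esym.
  have Gy : G y \in unitmx.
    rewrite unitmxE unitfE; near: y.
    exact: cvgr_neq0 (differentiable_continuous dd) Gx.
  (* Here the constant rank enters: the rows of [C y] lie in the range of [M y], are independent by
     the Gram matrix, and are as many as its dimension. *)
  have CM : (C y :=: (M y)^T)%MS.
    apply/eqmxP; have CM : (C y <= (M y)^T)%MS by rewrite /C trmx_mul submxMl.
    apply/andP; split=> //; rewrite -(mxrank_leqif_sup CM) (mxrank_tr (M y)).
    have -> : \rank (M y) = \rank (M x) by near: y.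
    by move: Gy; rewrite gram_unit /row_free.
  have wE : w y = e y - e y *m (C y)^T *m invmx (G y) *m C y.
    by rewrite /w /invmx Gy -scalemxAr -scalemxAl.
  apply: vertical_eq.
    by rewrite wE opprB addrC subrK -CM submxMl.
  have /submxP[D MD] : ((M y)^T <= C y)%MS by rewrite CM.
  apply/sub_kermxP; rewrite -[M y]trmxK MD trmx_mul mulmxA.
  by rewrite wE mulmxBl -!mulmxA -/(G y) mulVmx// mulmx1 subrr mul0mx.
apply: differentiableB => //; apply: differentiable_scalemx.
  exact: differentiableV.
do 2!apply: differentiable_mulmx => //; first exact: differentiable_mulmx.
exact: differentiable_adjugate.
Unshelve. all: by end_near. Qed.

(** * The Aronsson system *)

Lemma mxipC {R : realType} {m p : nat} (A B : 'M[R]_(m, p)) : mxip A B = mxip B A.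
Proof. by apply: eq_bigr => i _; apply: eq_bigr => j _; rewrite mulrC. Qed.

Lemma mxip_row {R : realType} {m : nat} (a b : 'rV[R]_m) :
  mxip a b = (a *m b^T) 0 0.
Proof. by rewrite /mxip big_ord1 mxE; apply: eq_bigr => j _; rewrite mxE. Qed.

Lemma mxip_tensor {R : realType} {m : nat} (A : 'M[R]_m) (w : 'rV[R]_m) :
  mxip A (tensor w) = (w *m A *m w^T) 0 0.
Proof.
rewrite mxE /mxip exchange_big; apply: eq_bigr => j _.
rewrite !mxE mulr_suml; apply: eq_bigr => i _; rewrite !mxE; ring.
Qed.

Lemma mxip_ge0 {R : realType} {m p : nat} (A : 'M[R]_(m, p)) : 0 <= mxip A A.
Proof. by apply: sumr_ge0 => i _; apply: sumr_ge0 => j _; rewrite -expr2 sqr_ge0. Qed.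

Lemma enorm_gt0 {R : realType} {m : nat} (w : 'rV[R]_m) : w != 0 -> 0 < enorm w.
Proof.
move=> w0; rewrite sqrtr_gt0 lt_neqAle mxip_ge0 andbT; apply: contra w0 => /eqP w0.
apply/eqP/mulmx_tr_eq0/matrixP => i j.
by rewrite !ord1 -mxip_row -w0 mxE.
Qed.

Lemma enormZ {R : realType} {m : nat} (k : R) (w : 'rV[R]_m) :
  enorm (k *: w) = `|k| * enorm w.
Proof.
rewrite /enorm !mxip_row linearZ -scalemxAl -scalemxAr scalerA mxE.
by rewrite sqrtrM -expr2 ?sqr_ge0// sqrtr_sqr.
Qed.

Section Coercivity.
Context {R : realType} {N n : nat} (H : 'M[R]_(N, n) -> R) (omega : R -> R).
Hypotheses (omega_mod : modulus omega) (H_coercive : coercive_HP H omega).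

(** Coercivity is stated for unit vectors; it is applied to [w] divided by its norm and multiplied
    by the squared norm. *)
Lemma coercive_scaled (Q : 'M[R]_(N, n)) (w : 'rV[R]_N) : w != 0 ->
  enorm w ^+ 2 * omega ((enorm w)^-1 * enorm (w *m Q)) <=
  (w *m HP H Q *m Q^T *m w^T) 0 0.
Proof.
move=> w0; have s0 := enorm_gt0 _ w0; set s := enorm w in s0 *.
have sw : enorm (s^-1 *: w) = 1.
  by rewrite enormZ normfV gtr0_norm// mulVf// gt_eqF.
have := H_coercive Q _ sw; rewrite mxip_tensor -scalemxAl enormZ normfV gtr0_norm//.
rewrite linearZ -!scalemxAl -scalemxAr scalerA mxE !mulmxA.
rewrite -(ler_pM2l (exprn_gt0 2 s0)) => /le_trans; apply.
rewrite mulrA (_ : s ^+ 2 * _ = 1) ?mul1r//.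
by field; rewrite gt_eqF.
Qed.

Lemma modulus_ge0 (s : R) : 0 <= s -> 0 <= omega s.
Proof.
have [w0 wp _ _ _] := omega_mod; rewrite le_eqVlt => /predU1P[<-|/wp/ltW//].
by rewrite w0.
Qed.

Lemma coercive_ge0 (Q : 'M[R]_(N, n)) (w : 'rV[R]_N) :
  0 <= (w *m HP H Q *m Q^T *m w^T) 0 0.
Proof.
have [->|w0] := eqVneq w 0; first by rewrite !mul0mx mxE.
apply: le_trans (coercive_scaled Q _ w0); rewrite mulr_ge0// ?sqr_ge0// modulus_ge0//.
by rewrite mulr_ge0// ?invr_ge0 sqrtr_ge0.
Qed.

(** Were [w *m Q] nonzero, the left side of [coercive_scaled] would be positive while the right side
    is 0. *)
Lemma coercive_null (Q : 'M[R]_(N, n)) (w : 'rV[R]_N) :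
  w *m HP H Q = 0 -> w *m Q = 0.
Proof.
move=> wH; have [->|w0] := eqVneq w 0; first by rewrite mul0mx.
apply/eqP; apply: contraT => /enorm_gt0 wQ; have s0 := enorm_gt0 _ w0.
have := coercive_scaled Q _ w0; rewrite wH !mul0mx mxE leNgt.
have [_ wp _ _ _] := omega_mod.
by rewrite mulr_gt0// ?exprn_gt0// wp// mulr_gt0// invr_gt0.
Qed.

End Coercivity.

Lemma grad_derive {R : realType} {N n : nat} (u : 'rV[R]_n -> 'rV[R]_N) x b j :
  differentiable u x -> grad u x b j = 'D_(delta_mx 0 j) u x 0 b.
Proof. by move=> du; rewrite !mxE deriveE. Qed.

Lemma C1_grad {R : realType} {N n : nat} (u : 'rV[R]_n -> 'rV[R]_N) :
  C2 u -> C1 (grad u).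
Proof.
move=> u2; apply: C1_mx => b j.
rewrite (_ : (fun y => _) = fun y => 'D_(delta_mx 0 j) u y 0 b).
  by apply: C1_coord; exact: u2.2.
by apply/funext => y; rewrite grad_derive//; exact: u2.1.1.
Qed.

Lemma C1_HP {R : realType} {N n : nat} (H : 'M[R]_(N, n) -> R) : C2 H -> C1 (HP H).
Proof.
move=> H2; apply: C1_mx => a i; under eq_fun do rewrite mxE.
exact: H2.2.
Qed.

(** Along each coordinate line through [P] the function has an interior minimum at parameter 0. *)
Lemma HP_min {R : realType} {N n : nat} (H : 'M[R]_(N, n) -> R) P :
  (forall Q, differentiable H Q) -> (forall Q, H P <= H Q) -> HP H P = 0.
Proof.
move=> dH Hmin; apply/matrixP => a i; rewrite !mxE.
pose l (t : R) : 'M[R]_(N, n) := P + t *: delta_mx a i.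
have dl t : is_derive t (1 : R) l (delta_mx a i).
  apply: (@is_derive1_quadratic _ _ _ _ 1 0) => // s _.
  by rewrite mul0r scalerBl opprD addrACA subrr add0r subrr normr0.
have dl' t : differentiable l t by apply/derivable1_diffP; have [] := dl t.
have := @derive1_at_min R (fun t => H (l t)) (- 1) 1 0.
case=> //.
- by move=> t _; apply/derivable1_diffP/differentiable_comp.
- by rewrite in_itv /= ltrN10 ltr01.
- by move=> t _; rewrite /l scale0r addr0.
move=> _; rewrite (derive_comp _ _ _ _ (dl' 0) (dH _)).
by have [_ ->] := dl 0; rewrite /l scale0r addr0.
Qed.

Section Aronsson.
Context {R : realType} {N n : nat} (H : 'M[R]_(N, n) -> R) (H_C2 : C2 H).
Context (u : 'rV[R]_n -> 'rV[R]_N) (u_C2 : C2 u) (u_aronsson : aronsson H u).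

Let M y := HP H (grad u y).

Definition grad_energy x : 'rV[R]_n :=
  \row_i 'D_(delta_mx 0 i) (fun y => H (grad u y)) x.

(** By the chain rule this is the contraction of [HPP] with the Hessian of [u] that occurs in the
    second term of the system. *)
Definition div_HP x : 'rV[R]_N :=
  \row_c \sum_i 'D_(delta_mx 0 i) (fun y => M y c i) x.

Let M_C1 : C1 M.
Proof. by apply: C1_comp; [exact: C1_grad|exact: C1_HP]. Qed.

Let dgrad x : differentiable (grad u) x.
Proof. exact: (C1_grad _ u_C2).1. Qed.

Lemma differentiable_energy x : differentiable (fun y => H (grad u y)) x.
Proof. by apply: differentiable_comp; [exact: dgrad|exact: H_C2.1.1]. Qed.

Lemma derive_grad_delta {W : normedModType R} (g : 'M[R]_(N, n) -> W) x i :
  differentiable g (grad u x) ->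
  'D_(delta_mx 0 i) (fun y => g (grad u y)) x =
  \sum_b \sum_j hess u x i j b *: 'D_(delta_mx b j) g (grad u x).
Proof.
move=> dg; rewrite (derive_comp _ _ _ _ (dgrad x) dg) derive_delta//.
by apply: eq_bigr => b _; apply: eq_bigr => j _; rewrite /hess derive_coord.
Qed.

Lemma aronsson_decomp x :
  grad_energy x *m (M x)^T + H (grad u x) *: vertical (M x) (div_HP x) = 0.
Proof.
apply/rowP => a; rewrite [RHS]mxE -[RHS](u_aronsson x a) !mxE.
under [RHS]eq_bigr do under eq_bigr do under eq_bigr do rewrite mulrDl.
under [RHS]eq_bigr do under eq_bigr do rewrite big_split.
under [RHS]eq_bigr do rewrite big_split.
rewrite big_split; congr (_ + _).
  rewrite exchange_big; apply: eq_bigr => i _; rewrite !mxE.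
  rewrite derive_grad_delta; last exact: H_C2.1.1.
  rewrite mulr_suml; apply: eq_bigr => b _; rewrite mulr_suml.
  apply: eq_bigr => j _; rewrite !mxE /GRing.scale /=; ring.
rewrite mulr_sumr /=.
(* With the sum over [c] outermost, the inner sums are the chain rule for the divergence of row [c]
   of [M]. *)
transitivity (\sum_c \sum_b \sum_i \sum_j H (grad u x) *
  (perp (M x) a c * HPP H (grad u x) c i b j) * hess u x i j b).
  apply: eq_bigr => c _; rewrite mxE mulr_suml mulr_sumr [RHS]exchange_big.
  apply: eq_bigr => i _; rewrite (derive_grad_delta (fun Q => HP H Q c i)); last first.
    exact: (C1_coord _ _ _ (C1_HP _ H_C2)).1.
  rewrite mulr_suml mulr_sumr; apply: eq_bigr => b _.
  rewrite mulr_suml mulr_sumr; apply: eq_bigr => j _.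
  rewrite [perp _ _ _]mxE /HPP /GRing.scale /=; ring.
rewrite exchange_big; apply: eq_bigr => b _; rewrite exchange_big.
apply: eq_bigr => i _; rewrite exchange_big; apply: eq_bigr => j _.
by rewrite -mulr_suml -mulr_sumr.
Qed.

Lemma aronsson_split x : grad_energy x *m (M x)^T = 0 /\
  H (grad u x) *: vertical (M x) (div_HP x) = 0.
Proof.
apply: (range_ker_eq0 (M x)); last exact: aronsson_decomp.
- exact: submxMl.
- exact/scalemx_sub/vertical_ker.
Qed.

Lemma derive_energy x w :
  'D_w (fun y => H (grad u y)) x = (w *m (grad_energy x)^T) 0 0.
Proof.
rewrite derive_delta; last exact: differentiable_energy.
by rewrite big_ord1 mxE; apply: eq_bigr => i _; rewrite !mxE.
Qed.

Lemma derive_energy_range x w :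
  'D_(w *m M x) (fun y => H (grad u y)) x = 0.
Proof.
rewrite derive_energy -mulmxA -[M x]trmxK -trmx_mul (aronsson_split x).1.
by rewrite trmx0 mulmx0 mxE.
Qed.

Lemma vertical_div_eq0 (H_ge0 : forall P, 0 <= H P) x (v : 'rV[R]_n -> 'rV[R]_N) :
  (forall y, v y *m M y = 0) -> differentiable v x ->
  mxip (grad v x) (M x) = 0.
Proof.
move=> vM dv.
have dvM i : \sum_a ('D_(delta_mx 0 i) v x 0 a * M x a i +
    v x 0 a * 'D_(delta_mx 0 i) (fun y => M y a i) x) = 0.
  transitivity ('D_(delta_mx 0 i) (fun y => (v y *m M y) 0 i) x).
    rewrite (_ : (fun y => _) = fun y => \sum_a v y 0 a * M y a i); last first.
      by apply/funext => y; rewrite mxE.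
    have dM a : differentiable (fun y => M y a i) x.
      exact: (C1_coord _ _ _ M_C1).1.
    have dva a : differentiable (fun y => v y 0 a) x.
      exact: differentiable_coord_comp.
    rewrite derive_sumr => [|a]; last exact: differentiableM.
    apply: eq_bigr => a _; have := @deriveM _ _ _ _ x (delta_mx 0 i)
      (diff_derivable (dva a)) (diff_derivable (dM a)).
    by rewrite (derive_coord v _ _ _ _ dv) addrC [M x a i *: _]mulrC => ->.
  rewrite (_ : (fun y => _) = cst 0) ?derive_cst//.
  by apply/funext => y; rewrite vM mxE.
have [H0|H0] := eqVneq (H (grad u x)) 0.
  have M0 a i : M x a i = 0.
    by rewrite /M HP_min ?mxE// => Q; [exact: H_C2.1.1|rewrite H0].
  by rewrite /mxip big1// => a _; rewrite big1// => i _; rewrite M0 mulr0.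
have -> : mxip (grad v x) (M x) = - mxip (div_HP x) (v x).
  apply/eqP; rewrite -addr_eq0; apply/eqP.
  have <- : \sum_i \sum_a ('D_(delta_mx 0 i) v x 0 a * M x a i +
    v x 0 a * 'D_(delta_mx 0 i) (fun y => M y a i) x) = 0 by exact: big1.
  rewrite /mxip big_ord1 exchange_big.
  under [RHS]eq_bigr do rewrite big_split.
  rewrite big_split; congr (_ + _).
    apply: eq_bigr => i _; apply: eq_bigr => a _.
    by rewrite grad_derive.
  rewrite exchange_big; apply: eq_bigr => a _.
  by rewrite mxE mulr_suml; apply: eq_bigr => i _; rewrite mulrC.
(* The vertical part of [div_HP x] vanishes, so [div_HP x] lies in the range of [M x], orthogonal to
   [v x]. *)
have /eqP := (aronsson_split x).2; rewrite scaler_eq0 (negPf H0) /= => /eqP div0.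
rewrite (range_ker_ip (M x)) ?oppr0//; last exact/sub_kermxP.
by rewrite -[div_HP x]subr0 -div0 vertical_range.
Qed.
End Aronsson.

(** * Construction of the split, the cover and the flow *)

Theorem theorem5p1 (R : realType) (N n : nat) (hN : (0 < N)%N) (hn : (0 < n)%N)
  (H : 'M[R]_(N, n) -> R) (H_C2 : C2 H) (H_ge0 : forall P, 0 <= H P)
  (H_coercive : exists omega : R -> R, modulus omega /\ coercive_HP H omega)
  (u : 'rV[R]_n -> 'rV[R]_N) (u_C2 : C2 u) (u_aronsson : aronsson H u)
  (Omega : set 'rV[R]_n) (Omega_open : open Omega)
  (rank_cst : exists r : nat,
     forall x, Omega x -> \rank (HP H (grad u x)) = r)
  (e : 'rV[R]_n -> 'rV[R]_N) (e_C1 : C1 e)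
  (e_unit : forall x, enorm (e x) = 1) :
  exists h v : 'rV[R]_n -> 'rV[R]_N,
    let Omega_top := [set x | Omega x /\ h x <> 0] in
    let Omega_perp := [set x | Omega x /\ v x <> 0] in
    [/\ (forall x, [/\ e x = h x + v x, mxip (h x) (v x) = 0,
                       (h x <= (HP H (grad u x))^T)%MS &
                       (v x <= kermx (HP H (grad u x)))%MS]),
        [/\ open Omega_top, open Omega_perp &
            Omega = Omega_top `|` Omega_perp],
        (exists (J : 'rV[R]_n -> set R)
                (Phi : R -> 'rV[R]_n -> 'rV[R]_n),
          flow (fun y => h y *m HP H (grad u y)) Omega_top J Phi /\
          (forall x t, Omega_top x -> J x t ->
             H (grad u (Phi t x)) = H (grad u x) /\
             0 <= mxip (h (Phi t x)) (derive1 (fun s => u (Phi s x)) t))) &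
        (forall x, Omega_perp x ->
           [/\ v x *m grad u x = 0,
               differentiable v x &
               mxip (grad v x) (HP H (grad u x)) = 0])].
Proof.
pose M y := HP H (grad u y).
pose v y := vertical (M y) (e y); pose h y := e y - v y.
have [omega [omega_mod coer]] := H_coercive.
have M1 : C1 M := C1_comp _ _ (C1_grad _ u_C2) (C1_HP _ H_C2).
have hE y : e y = h y + v y by rewrite /h subrK.
have vker y : (v y <= kermx (M y))%MS := vertical_ker _ _.
have vM y : v y *m M y = 0 by exact/sub_kermxP/vker.
have hran y : (h y <= (M y)^T)%MS := vertical_range _ _.
have hM y : h y *m M y = e y *m M y by rewrite mulmxBl vM subr0.
have dv x : Omega x -> differentiable v x.
  move=> Ox; apply: differentiable_vertical; [exact: M1.1|exact: e_C1.1|].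
  have [r rM] := rank_cst.
  apply: (filterS _ (open_nbhs_nbhs (conj Omega_open Ox))) => y Oy.
  exact: etrans (rM y Oy) (esym (rM x Ox)).
(* Continuity is required only at points of [Omega], since the fields may jump where the rank
   changes. *)
have open_ne (f : 'rV[R]_n -> 'rV[R]_N) :
    (forall x, Omega x -> {for x, continuous f}) ->
    open [set x | Omega x /\ f x <> 0].
  move=> cf; rewrite openE => x [Ox fx].
  apply: filterI; first exact: open_nbhs_nbhs (conj Omega_open Ox).
  by apply: (filterS _ (cvgr_neq0 _ (cf x Ox) (introN eqP fx))) => y /eqP.
have cv x : Omega x -> {for x, continuous v}.
  by move=> /dv/differentiable_continuous.
have ch x : Omega x -> {for x, continuous h}.
  by move=> Ox; exact: continuousB (C1_continuous _ e_C1 x) (cv x Ox).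
have otop := open_ne h ch.
exists h, v; split=> //.
- by move=> x; split=> //; exact: (range_ker_ip (M x)).
- split=> //; first exact: open_ne.
  apply/seteqP; split=> x; last by case=> -[].
  move=> Ox; have [h0|h0] := eqVneq (h x) 0; last by left; split=> //; exact/eqP.
  right; split=> // v0; have := e_unit x; rewrite hE h0 v0 addr0.
  rewrite /enorm mxip_row mul0mx mxE sqrtr0 => /esym/eqP; exact/negP/oner_neq0.
- have F1 : C1 (fun y => h y *m M y).
    rewrite (_ : (fun y => _) = fun y => e y *m M y); first exact: C1_mulmx.
    by apply/funext => y; exact: hM.
  have [J [Phi flowP]] := flow_exists _ F1 _ otop.
  exists J, Phi; split; first exact: flowP.
  move=> x t Ax Jt.
  have [[oJ iJ J0] Phi0 curve _] := flowP x Ax.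
  have dPhi s : J x s -> differentiable (Phi ^~ x) s.
    by move=> /curve[_ [/derivable1_diffP]].
  have PhiD s (Js : J x s) : 'D_1 (Phi ^~ x) s = h (Phi s x) *m M (Phi s x).
    by have [_ [_ ->]] := curve s Js.
  split.
    rewrite -[in RHS]Phi0.
    apply: (mean_value_cstr (fun s => H (grad u (Phi s x))) (J x)) => // s Js.
    have dE := differentiable_energy H H_C2 u u_C2 (Phi s x).
    apply: DeriveDef.
      by apply/derivable1_diffP; exact: differentiable_comp (dPhi s Js) dE.
    rewrite (derive_comp _ _ _ _ (dPhi s Js) dE) PhiD//.
    exact: derive_energy_range.
  have du := u_C2.1.1 (Phi t x).
  rewrite derive1E (derive_comp _ _ _ _ (dPhi t Jt) du) PhiD// deriveEjacobian//.
  (* The velocity of [u] along the flow is [h M Du^T], so its product with [h] is the quadratic form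
     of the coercivity condition. *)
  rewrite mxipC mxip_row -[jacobian _ _]trmxK.
  exact: (coercive_ge0 H omega omega_mod coer (grad u (Phi t x)) (h (Phi t x))).
move=> x [Ox vx]; split; last 2 first.
- exact: dv.
- exact: (vertical_div_eq0 H H_C2 u u_C2 u_aronsson H_ge0 x v vM (dv x Ox)).
exact: (coercive_null H omega omega_mod coer _ _ (vM x)).
Qed.
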